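(* Let $m,n$ be positive integers such that $d=m-n$ is positive and odd, and let $p$ be a prime. Then $$\nu_p(S(m,n))\ \ge\ \begin{cases}\nu_p(e(n))-1 & \text{if } p=2,\\ \nu_p(e(n)) & \text{otherwise.}\end{cases}$$
   Context: $S(m,n)$ denotes the Stirling number of the second kind. $\nu_p$ is the $p$-adic valuation: $\nu_p(N)=\max\{\kappa\in\mathbb{N}: p^{\kappa}\mid N\}$ for a positive integer $N$. For a positive integer $n$, $e(n)=n$ if $n$ is even and $e(n)=n+1$ if $n$ is odd. *)

(* Defs.v *)
From mathcomp Require Import all_boot.

Set Implicit Arguments.
Unset Strict Implicit.
Unset Printing Implicit Defensive.

(* [partition P D] requires [set0 \notin P], so all the blocks counted here are
   nonempty. *)
Definition stirling2 (m n : nat) : nat :=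
  #|[set P : {set {set 'I_m}} | partition P [set: 'I_m] & #|P| == n]|.

Definition even_ceil (n : nat) : nat := if odd n then n.+1 else n.

(* Main.v *)
Require Import Defs.
From mathcomp Require Import all_boot.
From mathcomp Require Import ssralg zmodp ring.

Set Implicit Arguments.
Unset Strict Implicit.
Unset Printing Implicit Defensive.

(** Write [d = m - n] and [N = even_ceil n]. The Stirling number [S(n + d, n)]
    is the complete homogeneous symmetric polynomial [h_d] evaluated at
    [1, ..., n], because both obey the triangular recurrence
    [S(n+1+d+1, n+1) = S(n+d+1, n) + (n+1) S(n+1+d, n+1)]
    ([card_partitions_setU1], [chom_stirling]).

    Modulo [N], the points [1, ..., n] are [1, ..., N - 1], followed by
    [N = 0] when [n] is even, and a zero point does not change [h_d].  The
    involution [i |-> N - i] is negation modulo [N] and only reverses the list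
    [1, ..., N - 1]; as [h_d] is symmetric and homogeneous of degree [d], this
    gives [h_d = (-1)^d h_d] modulo [N] ([chom_opp], [chom_rev]).  For odd [d],
    [N] therefore divides [2 S(n + d, n)], for every prime at once; the factor
    [2] is the loss of one in the valuation at [p = 2]. *)

(** * Set partitions and the triangular recurrence *)

Section SetPartitions.
Variable T : finType.
Implicit Types (x : T) (B D : {set T}) (P Q : {set {set T}}).

(** For [B = set0] this adjoins the singleton block [[set x]], so that both
    ways of extending a partition by a new point are covered by one formula. *)
Definition insert_in_block x Q B : {set {set T}} := (x |: B) |: (Q :\ B).

Definition delete_point x P : {set {set T}} :=
  ((pblock P x :\ x) |: (P :\ pblock P x)) :\ set0.

Lemma block_notin x D Q B : x \notin D -> partition Q D ->
  B \in set0 |: Q -> x \notin B.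
Proof.
move=> xD partQ; rewrite !inE => /orP[/eqP-> | BQ]; first by rewrite inE.
by apply: contra xD; apply/subsetP: x; apply: partitionS partQ BQ.
Qed.

Lemma partition_insert x D Q B : x \notin D -> partition Q D ->
  B \in set0 |: Q -> partition (insert_in_block x Q B) (x |: D).
Proof.
move=> xD partQ BQ0; have xB := block_notin xD partQ BQ0.
have [BD partQB] : B \subset D /\ partition (Q :\ B) (D :\: B).
  move: BQ0; rewrite !inE => /orP[/eqP-> | BQ].
    rewrite sub0set setD0; split=> //.
    suff -> : Q :\ set0 = Q by [].
    apply/setP=> C; rewrite !inE andbC; case CQ: (C \in Q) => //=.
    exact: partition_neq0 partQ CQ.
  by split; [apply: partitionS partQ BQ | apply: partitionD1].
have -> : x |: D = (x |: B) :|: (D :\: B).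
  by rewrite -setUA -{1}(setID D B) (setIidPr BD).
apply: partitionU1 => //; first by apply/set0Pn; exists x; rewrite setU11.
rewrite -setI_eq0; apply/eqP/setP=> y; rewrite !inE.
by case: eqP => [->|_] /=; [rewrite (negPf xD) andbF | case: (y \in B)].
Qed.

Lemma pblock_insert x D Q B : x \notin D -> partition Q D ->
  B \in set0 |: Q -> pblock (insert_in_block x Q B) x = x |: B.
Proof.
move=> xD partQ BQ; apply: def_pblock; rewrite ?setU11 //.
exact: partition_trivIset (partition_insert xD partQ BQ).
Qed.

Lemma insert_block_notin x D Q B : x \notin D -> partition Q D ->
  x |: B \notin Q.
Proof.
move=> xD partQ; apply/negP => /(partitionS partQ)/subsetP/(_ x).
by rewrite setU11 (negPf xD) => /(_ isT).
Qed.

Lemma delete_insert x D Q B : x \notin D -> partition Q D ->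
  B \in set0 |: Q -> delete_point x (insert_in_block x Q B) = Q.
Proof.
move=> xD partQ BQ; rewrite /delete_point (pblock_insert xD partQ BQ).
have nQ := insert_block_notin B xD partQ.
rewrite /insert_in_block setU1K ?(block_notin xD partQ BQ) //.
rewrite setU1K; last by rewrite !inE negb_and nQ orbT.
have Q0 : set0 \notin Q by case/and3P: partQ.
apply/setP=> C; rewrite !inE; move: BQ; rewrite !inE.
case: (eqVneq C B) => [->|_]; last first.
  by move=> _; case: eqP => [->|//]; rewrite (negPf Q0).
by case: eqP => [->|_ /= ->] //; rewrite (negPf Q0).
Qed.

Lemma card_insert x D Q B : x \notin D -> partition Q D ->
  B \in set0 |: Q -> #|insert_in_block x Q B| = #|Q| + (B == set0).
Proof.
move=> xD partQ BQ; rewrite /insert_in_block cardsU1.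
rewrite !inE negb_and (insert_block_notin B xD partQ) orbT /=.
have Q0 : set0 \notin Q by case/and3P: partQ.
move: BQ; rewrite (cardsD1 B Q) !inE.
by case: eqP => [->|_ /= ->]; rewrite ?(negPf Q0) ?addn0 // addnC.
Qed.

(** Every partition of [x |: D] arises by inserting [x], and the block to
    insert it in is what is left of the block of [x]. *)
Lemma insert_delete x D P : x \notin D -> partition P (x |: D) ->
  let Q := delete_point x P in let B := pblock P x :\ x in
  [/\ partition Q D, B \in set0 |: Q & insert_in_block x Q B = P].
Proof.
move=> xD partP; set C := pblock P x.
have xcov : x \in cover P by rewrite (cover_partition partP) setU11.
have CP : C \in P by rewrite pblock_mem.
have xC : x \in C by rewrite mem_pblock.
have P0 : set0 \notin P by case/and3P: partP.
have CD : C \subset x |: D := partitionS partP CP.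
have partPC := partitionD1 partP CP.
have BD : C :\ x \subset D by rewrite subDset.
have eqD : (x |: D) :\: C = D :\: (C :\ x).
  apply/setP=> y; rewrite !inE; case: eqP => [->|_] //=.
  by rewrite xC (negPf xD).
rewrite eqD in partPC.
have notB : C :\ x \notin P :\ C.
  apply/negP=> BPC; have Bn0 := partition_neq0 partPC BPC.
  have /subsetP BB := partitionS partPC BPC.
  by case/set0Pn: Bn0 => y yB; have := BB y yB; rewrite inE yB.
have P0C : set0 \notin P :\ C by rewrite inE (negPf P0) andbF.
rewrite /= /delete_point -/C /insert_in_block (setD1K xC).
have [B0|Bn0] := eqVneq (C :\ x) set0.
  rewrite B0 setU1K // in partPC *; rewrite setD0 in partPC.
  split=> //; first by rewrite setU11.
  have -> : P :\ C :\ set0 = P :\ C.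
    apply/setP=> E; rewrite !inE; case: eqP => [->|//].
    by rewrite (negPf P0) andbF.
  exact: setD1K.
have -> : (C :\ x |: P :\ C) :\ set0 = C :\ x |: P :\ C.
  apply/setP=> E; rewrite in_setD1; case: eqP => [->|//].
  by rewrite in_setU1 (negPf P0C) orbF eq_sym (negPf Bn0).
split; last by rewrite setU1K // setD1K.
  have -> : D = (C :\ x) :|: (D :\: (C :\ x)).
    by rewrite -{1}(setID D (C :\ x)) (setIidPr BD).
  by apply: partitionU1; rewrite // -setI_eq0 [D :\: _]setDE setICA setICr setI0.
by rewrite !in_setU1 eqxx orbT.
Qed.

Definition partitions D n : {set {set {set T}}} :=
  [set P | partition P D & #|P| == n].

(** Insertion is a bijection from the pairs [(Q, B)] with [B = set0] or
    [B \in Q]: the first kind needs [n] blocks in [Q], and the second [n + 1],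
    each of which can be [B]. *)
Lemma card_partitions_setU1 x D n : x \notin D ->
  #|partitions (x |: D) n.+1| = #|partitions D n| + n.+1 * #|partitions D n.+1|.
Proof.
move=> xD.
pose X1 := [set (Q, set0 : {set T}) | Q in partitions D n].
pose X2 := [set QB : {set {set T}} * {set T} |
            (QB.1 \in partitions D n.+1) && (QB.2 \in QB.1)].
pose ins (QB : {set {set T}} * {set T}) := insert_in_block x QB.1 QB.2.
have XP QB : QB \in X1 :|: X2 -> [/\ partition QB.1 D, QB.2 \in set0 |: QB.1
    & #|QB.1| + (QB.2 == set0) == n.+1].
  case/setUP => [/imsetP[Q] | ].
    by rewrite inE => /andP[pQ /eqP cQ] -> /=; rewrite setU11 eqxx cQ addn1.
  rewrite !inE => /andP[/andP[pQ /eqP cQ] BQ]; rewrite BQ orbT.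
  by rewrite (negPf (partition_neq0 pQ BQ)) cQ addn0.
have -> : partitions (x |: D) n.+1 = ins @: (X1 :|: X2).
  apply/setP=> P; apply/idP/imsetP => [|[[Q B] /XP[/= pQ BQ cQ] ->]]; last first.
    by rewrite inE partition_insert //= (card_insert xD pQ BQ).
  rewrite inE => /andP[pP /eqP cP].
  case: (insert_delete xD pP); set Q := delete_point x P; set B := _ :\ x.
  move=> pQ BQ insP; exists (Q, B); last by rewrite /ins insP.
  move: cP; rewrite -insP (card_insert xD pQ BQ) => /eqP cQ.
  have [B0|Bn0] := eqVneq B set0.
    apply/setUP; left; apply/imsetP; exists Q; last by rewrite B0.
    by move: cQ; rewrite B0 eqxx addn1 eqSS inE pQ.
  by move: BQ cQ; rewrite !inE (negPf Bn0) /= addn0 pQ => -> ->; rewrite orbT.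
rewrite card_in_imset; last first.
  move=> [Q B] [Q' B'] /XP[/= pQ BQ _] /XP[/= pQ' BQ' _]; rewrite /ins /= => eqI.
  have eqQ : Q = Q' by rewrite -(delete_insert xD pQ BQ) eqI (delete_insert xD pQ' BQ').
  have: x |: B = x |: B'.
    by rewrite -(pblock_insert xD pQ BQ) eqI (pblock_insert xD pQ' BQ').
  move/(congr1 (fun C : {set T} => C :\ x)).
  rewrite !setU1K ?(block_notin xD pQ BQ) ?(block_notin xD pQ' BQ') //.
  by rewrite eqQ => ->.
rewrite cardsU; have -> : X1 :&: X2 = set0.
  apply/setP=> QB; rewrite [RHS]inE; apply/negP => /setIP[/imsetP[Q _ ->]].
  by rewrite !inE /= => /andP[/andP[/and3P[_ _ /negPf->]]].
rewrite cards0 subn0 card_in_imset; last by move=> Q Q' _ _ [].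
congr (_ + _); rewrite -sum1dep_card.
rewrite -(pair_big_dep (fun Q => Q \in partitions D n.+1)
            (fun Q (B : {set T}) => B \in Q) (fun _ _ => 1)) /=.
under eq_bigr => Q; first by rewrite inE sum1_card => /andP[_ /eqP->]; over.
by rewrite sum_nat_const mulnC.
Qed.

End SetPartitions.

Fixpoint stirling_rec (m n : nat) : nat :=
  match m, n with
  | 0, 0 => 1
  | m'.+1, n'.+1 => stirling_rec m' n' + n * stirling_rec m' n
  | _, _ => 0
  end.

Lemma stirling_recSS m n :
  stirling_rec m.+1 n.+1 = stirling_rec m n + n.+1 * stirling_rec m n.+1.
Proof. by []. Qed.

(** Counting on all subsets of a fixed type lets the induction remove points
    without changing the ambient type. *)
Lemma card_partitions (T : finType) (D : {set T}) n :
  #|partitions D n| = stirling_rec #|D| n.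
Proof.
move cD: #|D| => m; elim: m D cD n => [|m IHm] D cD n.
  have -> : D = set0 by apply: cards0_eq.
  have eqP0 (P : {set {set T}}) : partition P set0 = (P == set0).
    exact: partition_set0.
  case: n => [|n] /=.
    rewrite (_ : partitions _ _ = [set set0]) ?cards1 //.
    by apply/setP=> P; rewrite !inE eqP0; case: eqP => [->|]; rewrite ?cards0.
  rewrite (_ : partitions _ _ = set0) ?cards0 //.
  by apply/setP=> P; rewrite !inE eqP0; case: eqP => [->|]; rewrite ?cards0.
have [x xD] : exists x, x \in D by apply/card_gt0P; rewrite cD.
have cDx : #|D :\ x| = m by move: cD; rewrite (cardsD1 x) xD => -[].
case: n => [|n] /=.
  rewrite (_ : partitions _ _ = set0) ?cards0 //.
  apply/setP=> P; rewrite !inE cards_eq0; apply/negP => /andP[pP /eqP P0].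
  by move: xD; rewrite -(cover_partition pP) P0 /cover big_set0 inE.
by rewrite -{1}(setD1K xD) card_partitions_setU1 ?setD11 // !IHm.
Qed.

Lemma stirling2E m n : stirling2 m n = stirling_rec m n.
Proof. by have := card_partitions [set: 'I_m] n; rewrite cardsT card_ord. Qed.

Lemma stirling_rec_small m n : m < n -> stirling_rec m n = 0.
Proof.
elim: m n => [|m IHm] [|n] //= lt_mn.
by rewrite !IHm ?muln0 // ltnW.
Qed.

Lemma stirling_recnn n : stirling_rec n n = 1.
Proof. by elim: n => //= n ->; rewrite stirling_rec_small ?muln0. Qed.

Lemma stirling_rec_gt0 n d : 0 < n -> 0 < stirling_rec (n + d) n.
Proof.
case: n => // n _; elim: d => [|d IHd]; first by rewrite addn0 stirling_recnn.
by rewrite addnS stirling_recSS addn_gt0 muln_gt0 IHd orbT.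
Qed.

(** * Complete homogeneous symmetric polynomials *)

Section CompleteHomogeneous.
Import GRing.Theory.
Local Open Scope ring_scope.
Variable R : comNzRingType.
Implicit Types (x y : R) (s : seq R) (f : nat -> R) (d : nat).

(** The coefficients of [F(t) / (1 - x t)], when [f] lists those of [F(t)]. *)
Fixpoint div_factor x f d : R :=
  if d is d'.+1 then f d + x * div_factor x f d' else f 0.

(** [chom s d] is the coefficient of [t^d] in the inverse of the product of the
    [1 - x t] for [x] in [s]. *)
Definition chom s : nat -> R := foldr div_factor (fun d => (d == 0)%:R) s.

Lemma eq_div_factor x f g : f =1 g -> div_factor x f =1 div_factor x g.
Proof. by move=> fg; elim=> [|d IHd] /=; rewrite fg ?IHd. Qed.

(** Both sides, say [a], satisfy
    [a (d+2) = f (d+2) + (x + y) a (d+1) - x y a d], which is symmetric in [x]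
    and [y]. *)
Lemma div_factorC x y f :
  div_factor x (div_factor y f) =1 div_factor y (div_factor x f).
Proof.
move=> d; suff [] : div_factor x (div_factor y f) d
    = div_factor y (div_factor x f) d
  /\ div_factor x (div_factor y f) d.+1
    = div_factor y (div_factor x f) d.+1 by [].
elim: d => [|d [IH0 IH1]]; first by split=> //=; ring.
split=> //; move: IH0 IH1 => /=.
set a := div_factor x _ d; set b := div_factor y _ d => <-.
set u := div_factor y f d; set v := div_factor x f d => eq1.
have -> : f d.+2 + y * (f d.+1 + y * u) + x * (f d.+1 + y * u + x * a)
  = f d.+2 + (x + y) * (f d.+1 + y * u + x * a) - x * y * a by ring.
by rewrite eq1; ring.
Qed.

Lemma chom_rcons s x : chom (rcons s x) =1 chom (x :: s).
Proof.
elim: s => //= y s IHs d; rewrite -/(chom _).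
by rewrite (eq_div_factor _ IHs) div_factorC.
Qed.

(** The only instance of the symmetry of [chom] that the involution
    [i |-> N - i] of [1, ..., N - 1] calls for. *)
Lemma chom_rev s : chom (rev s) =1 chom s.
Proof.
elim: s => //= x s IHs d.
by rewrite rev_cons chom_rcons; apply: eq_div_factor.
Qed.

Lemma chom_cons0 s : chom (0 :: s) =1 chom s.
Proof. by case=> [|d] //=; rewrite mul0r addr0. Qed.

Lemma chom_opp s d : chom (map -%R s) d = (-1) ^+ d * chom s d.
Proof.
elim: s d => [|x s IHs] d /=; first by case: d => [|d]; rewrite ?mulr1 ?mulr0.
elim: d => [|d IHd] /=; first by rewrite -/(chom _) IHs.
by rewrite IHd -/(chom _) IHs exprS; ring.
Qed.

(** The points are listed in decreasing order so that the factor of the largest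
    one, which drives the triangular recurrence, is the outermost. *)
Lemma chom_stirling n d :
  chom [seq i%:R | i <- rev (iota 1 n)] d = (stirling_rec (n + d) n)%:R.
Proof.
elim: n d => [|n IHn]; first by case.
rewrite -[n.+1]addn1 iotaD rev_cat add1n addn1 /=.
elim=> [|d IHd] /=.
  rewrite -/(chom _) IHn addn0.
  by rewrite [stirling_rec n n.+1]stirling_rec_small ?muln0 ?addn0.
by rewrite [div_factor _ _ d]IHd -/(chom _) IHn -natrM -natrD !addnS.
Qed.

End CompleteHomogeneous.

(** * The congruence modulo the even ceiling *)

Section Congruence.
Import GRing.Theory.
Local Open Scope ring_scope.

Lemma opp_range_Zp N : (1 < N)%N ->
  map -%R [seq i%:R | i <- rev (iota 1 N.-1)]
    = [seq i%:R | i <- iota 1 N.-1] :> seq 'Z_N.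
Proof.
move=> N_gt1; apply: (@eq_from_nth _ 0); first by rewrite !size_map size_rev.
move=> i; rewrite !size_map size_rev size_iota => lt_i.
rewrite (nth_map 0) ?size_map ?size_rev ?size_iota //.
rewrite !(nth_map 0%N) ?size_rev ?size_iota // nth_rev ?size_iota //.
have lt_j : (N.-1 - i.+1 < N.-1)%N by rewrite ltn_subrL; case: (N.-1) lt_i.
rewrite !nth_iota //; apply/esym/eqP; rewrite -addr_eq0 -natrD.
suff -> : (1 + i + (1 + (N.-1 - i.+1)) = N)%N by rewrite pchar_Zp.
by rewrite !add1n addnS subnKC // prednK // ltnW.
Qed.

Lemma chom_range_Zp N d : (1 < N)%N -> odd d ->
  2 * chom [seq i%:R | i <- rev (iota 1 N.-1)] d = 0 :> 'Z_N.
Proof.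
move=> N_gt1 odd_d; set L := map _ _.
suff eqL : chom L d = - chom L d by rewrite mulr_natl mulr2n {2}eqL subrr.
have := chom_opp L d; rewrite opp_range_Zp // -signr_odd odd_d expr1 mulN1r => <-.
by rewrite -chom_rev -map_rev revK.
Qed.

Lemma even_ceil_dvd_stirling n d : (0 < n)%N -> odd d ->
  (even_ceil n %| 2 * stirling_rec (n + d) n)%N.
Proof.
move=> n_gt0 odd_d; set N := even_ceil n.
have N_gt1 : (1 < N)%N.
  by rewrite /N /even_ceil; case: n n_gt0 {N} => [|[|n]] //=; case: ifP.
suff : (2 * stirling_rec (n + d) n)%:R = 0 :> 'Z_N.
  by move/(congr1 val); rewrite /= val_Zp_nat // => /eqP.
rewrite natrM -chom_stirling -(chom_range_Zp N_gt1 odd_d); congr (_ * _).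
have [odd_n|even_n] := boolP (odd n); first by rewrite /N /even_ceil odd_n.
have -> : iota 1 n = rcons (iota 1 N.-1) N.
  rewrite /N /even_ceil (negPf even_n) -cats1 -{1}(prednK n_gt0).
  by rewrite -[n.-1.+1]addn1 iotaD add1n prednK.
(* The largest point vanishes modulo [N]. *)
by rewrite rev_rcons map_cons pchar_Zp // chom_cons0.
Qed.

End Congruence.

Theorem proposition8 (m n p : nat) (m_gt0 : 0 < m) (n_gt0 : 0 < n)
    (d_gt0 : 0 < m - n) (d_odd : odd (m - n)) (p_prime : prime p) :
  (if p == 2 then logn p (even_ceil n) - 1 else logn p (even_ceil n))
    <= logn p (stirling2 m n).
Proof.
have -> : m = n + (m - n) by rewrite subnKC // ltnW // -subn_gt0.
rewrite stirling2E; move: (m - n) d_odd => d d_odd.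
have S_gt0 := stirling_rec_gt0 d n_gt0.
have := dvdn_leq_log p _ (even_ceil_dvd_stirling n_gt0 d_odd).
rewrite muln_gt0 S_gt0 lognM // (logn_prime p (isT : prime 2)) eq_sym => /(_ isT).
by case: eqP => _; rewrite ?leq_subLR.
Qed.
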